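(* For every e-sequential exterior space $X$, the presheaf $\Sigma(X)=\mathbf{E}(-,X)$ on $\mathbb{C}$ is a sheaf for the Grothendieck topology $\mathbb{J}$; hence $\Sigma$ defines a full embedding (full, faithful and injective on objects) $\Sigma:\mathbf{Eseq}\hookrightarrow\mathcal{E}$ into the topos of sheaves $\mathcal{E}=\mathrm{sh}(\mathbb{C},\mathbb{J})$.
   Context: An externology on a topological space $(X,\tau)$ is a nonempty family $\varepsilon\subset\tau$ closed under finite intersections and such that $U\in\tau$, $E\in\varepsilon$, $U\supset E$ imply $U\in\varepsilon$ (possibly $\emptyset\in\varepsilon$). An exterior space $(X,\varepsilon\subset\tau)$ is a topological space with an externology; members of $\varepsilon$ are called e-open. An exterior map is a continuous map such that preimages of e-open sets are e-open. $\mathbf{E}$ is the category of exterior spaces and exterior maps. For a space $Y$, $Y_d$ is $Y$ with externology $\varepsilon=\tau$, and $Y_{cc}$ is $Y$ with externology the open sets with compact complement. $\mathbb{N}$ carries the discrete topology and $\mathbb{N}^+=\mathbb{N}\cup\{\infty\}$ is its one-point compactification. An exterior sequence in an exterior space $X$ is an exterior map $\mathbb{N}_{cc}\to X$, i.e. a sequence eventually in every e-open set. A subset $U$ of a space is sequentially open if every sequence converging to a point of $U$ is eventually in $U$; a space is sequential if sequentially open subsets are open. A subset of an exterior space is sequentially e-open if it is sequentially open and every exterior sequence is eventually in it. An exterior space is e-sequential if it is a sequential topological space and every sequentially e-open subset is e-open. $\mathbf{Eseq}$ is the full subcategory of $\mathbf{E}$ of e-sequential exterior spaces. $\mathbb{C}$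 is the (non-full) subcategory of $\mathbf{E}$ with objects $1=1_d$ (the one-point space), $\mathbb{N}^+=\mathbb{N}^+_d$, $\mathbb{N}=\mathbb{N}_{cc}$ and morphisms: $\mathbb{C}(1,1)=\{\mathrm{id}\}$; $\mathbb{C}(1,\mathbb{N}^+)$ and $\mathbb{C}(1,\mathbb{N})$ all maps (points); $\mathbb{C}(\mathbb{N}^+,1)=\{!\}$; $\mathbb{C}(\mathbb{N}^+,\mathbb{N}^+)=M^+$, the monoid of all continuous maps $\mathbb{N}^+\to\mathbb{N}^+$; $\mathbb{C}(\mathbb{N}^+,\mathbb{N})$ the set of constant maps; $\mathbb{C}(\mathbb{N},\mathbb{N})=M$, the monoid of all exterior maps $\mathbb{N}_{cc}\to\mathbb{N}_{cc}$ (i.e. finite-to-one maps); $\mathbb{C}(\mathbb{N},1)=\mathbb{C}(\mathbb{N},\mathbb{N}^+)=\emptyset$. For an exterior space $X$, $\Sigma(X)$ is the presheaf (of sets) on $\mathbb{C}$ given by $A\mapsto\mathbf{E}(A,X)$, with restriction by precomposition; for an exterior map $f$, $\Sigma(f)$ is post-composition with $f$. Let $E\subset M^+$ be the submonoid of monotone injective maps $u:\mathbb{N}^+\to\mathbb{N}^+$ (so $u^{-1}(\infty)=\{\infty\}$); forgetting $\infty$, $E$ is also regarded as the submonoid of $M$ of monotone injective maps $\mathbb{N}\to\mathbb{N}$. Ideals are right ideals (closed under precomposition with elements of the monoid). $\mathbb{J}_c$ is the set of ideals $I$ of $M^+$ that contain all constant maps $\mathbb{N}^+\to\mathbb{N}^+$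 and satisfy: for every $u\in E$ there is $v\in E$ with $u\circ v\in I$. $\mathbb{J}_e$ is the set of ideals $I$ of $M$ satisfying: for every $u\in E$ there is $v\in E$ with $u\circ v\in I$. The Grothendieck topology $\mathbb{J}$ on $\mathbb{C}$ is: the only member of $\mathbb{J}(1)$ is the family of all morphisms of $\mathbb{C}$ with codomain $1$; the members of $\mathbb{J}(\mathbb{N}^+)$ are the families consisting of all morphisms $1\to\mathbb{N}^+$ and the morphisms $\mathbb{N}^+\to\mathbb{N}^+$ belonging to some $I\in\mathbb{J}_c$; the members of $\mathbb{J}(\mathbb{N})$ are the families consisting of all morphisms $1\to\mathbb{N}$, all morphisms $\mathbb{N}^+\to\mathbb{N}$ of $\mathbb{C}$, and the morphisms $\mathbb{N}\to\mathbb{N}$ belonging to some $I\in\mathbb{J}_e$. *)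

(* Defs.v *)
From mathcomp Require Import all_boot.
From mathcomp Require Import all_classical.
From mathcomp Require Import topology.

Set Implicit Arguments.
Unset Strict Implicit.
Unset Printing Implicit Defensive.

Local Open Scope classical_set_scope.

Record category := Category {
  ob :> Type;
  hom : ob -> ob -> Type;
  idc : forall A, hom A A;
  comp : forall A B D, hom B D -> hom A B -> hom A D;
  comp_idl : forall A B (f : hom A B), comp (idc B) f = f;
  comp_idr : forall A B (f : hom A B), comp f (idc A) = f;
  comp_assoc : forall A B D F (h : hom D F) (g : hom B D) (f : hom A B),
    comp h (comp g f) = comp (comp h g) f }.

Arguments hom {c} A B.
Arguments idc {c} A.
Arguments comp {c A B D} g f.

Definition opcat (C : category) : category :=
  @Category (ob C) (fun A B => @hom C B A) (fun A => idc A)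
    (fun A B D g f => comp f g)
    (fun A B f => comp_idr f) (fun A B f => comp_idl f)
    (fun A B D F h g f => esym (comp_assoc f g h)).

Record functor (C D : category) := Functor {
  fobj :> ob C -> ob D;
  fmap : forall A B : C, hom A B -> hom (fobj A) (fobj B);
  fmap_id : forall A : C, fmap (idc A) = idc (fobj A);
  fmap_comp : forall (A B E : C) (g : hom B E) (f : hom A B),
    fmap (comp g f) = comp (fmap g) (fmap f) }.

Arguments fmap {C D} _ {A B} _.

Definition full (C D : category) (F : functor C D) : Prop :=
  forall (A B : C) (g : hom (F A) (F B)), exists f : hom A B, fmap F f = g.

Definition faithful (C D : category) (F : functor C D) : Prop :=
  forall A B : C, injective (@fmap C D F A B).

Definition full_embedding (C D : category) (F : functor C D) : Prop :=
  [/\ full F, faithful F & injective (fobj F)].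

Record nat_trans (C D : category) (F G : functor C D) := NatTrans {
  ncomp :> forall A : C, hom (F A) (G A);
  naturality : forall (A B : C) (f : hom A B),
    comp (ncomp B) (fmap F f) = comp (fmap G f) (ncomp A) }.

Lemma nat_trans_eq (C D : category) (F G : functor C D)
  (s t : nat_trans F G) : (forall A, s A = t A) -> s = t.
Proof.
case: s t => [s sN] [t tN] /= st.
have e : s = t by apply: functional_extensionality_dep.
by case: _ / e tN {st} => tN; congr NatTrans; apply: Prop_irrelevance.
Qed.

Program Definition functor_cat (C D : category) : category :=
  @Category (functor C D) (@nat_trans C D)
    (fun F => @NatTrans _ _ F F (fun A => idc (F A)) _)
    (fun F G H t s =>
       @NatTrans _ _ F H (fun A => comp (t A) (s A)) _) _ _ _.
Next Obligation. by move=> * /=; rewrite comp_idl comp_idr. Qed.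
Next Obligation.
move=> C D F G H t s A B f /=.
by rewrite -comp_assoc naturality !comp_assoc naturality.
Qed.
Next Obligation.
by move=> *; apply: nat_trans_eq => A /=; rewrite comp_idl.
Qed.
Next Obligation.
by move=> *; apply: nat_trans_eq => A /=; rewrite comp_idr.
Qed.
Next Obligation.
by move=> *; apply: nat_trans_eq => A /=; rewrite comp_assoc.
Qed.

Definition full_subcat (C : category) (P : C -> Prop) : category :=
  @Category {A : C | P A} (fun A B => @hom C (sval A) (sval B))
    (fun A => idc (sval A)) (fun A B D g f => comp g f)
    (fun A B f => comp_idl f) (fun A B f => comp_idr f)
    (fun A B D F h g f => comp_assoc h g f).

Definition restrict_functor (C D : category) (F : functor C D)
    (P : C -> Prop) (Q : D -> Prop) (PQ : forall A, P A -> Q (F A)) :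
    functor (full_subcat P) (full_subcat Q) :=
  @Functor (full_subcat P) (full_subcat Q)
    (fun A => exist Q (F (sval A)) (PQ (sval A) (svalP A)))
    (fun A B f => @fmap C D F (sval A) (sval B) f)
    (fun A => fmap_id F (sval A))
    (fun A B E g f => fmap_comp F g f).

(* Sets are subsets of types rather than bare types, so that an equality of
   sets with the same ambient type means having the same elements. Equalities
   between bare subtypes or function types say nothing about their members,
   which would leave injectivity on objects unprovable. *)
Record sset := SSet { ambient : Type; members :> set ambient }.

Arguments members : clear implicits.

Definition set_cat : category :=
  @Category sset (fun S T => members S -> members T)
    (fun S => id) (fun S T U g f => g \o f)
    (fun S T f => erefl) (fun S T f => erefl)
    (fun S T U W h g f => erefl).

Definition psh (C : category) : category := functor_cat (opcat C) set_cat.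

Record sieve (C : category) (A : C) := Sieve {
  arrow :> forall B : C, hom B A -> Prop;
  sieve_comp : forall (B D : C) (f : hom B A) (g : hom D B),
    arrow f -> arrow (comp f g) }.

Definition max_sieve (C : category) (A : C) : sieve A :=
  @Sieve C A (fun B f => True) (fun B D f g _ => I).

Program Definition pull_sieve (C : category) (A B : C) (f : hom B A)
    (S : sieve A) : sieve B :=
  @Sieve C B (fun D g => S D (comp f g)) _.
Next Obligation. by move=> /= *; rewrite comp_assoc; apply: sieve_comp. Qed.

Record groth_topology (C : category) := GrothTopology {
  cov :> forall A : C, sieve A -> Prop;
  cov_max : forall A : C, cov (max_sieve A);
  cov_pull : forall (A B : C) (f : hom B A) (S : sieve A),
    cov S -> cov (pull_sieve f S);
  cov_trans : forall (A : C) (S R : sieve A), cov S ->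
    (forall (B : C) (f : hom B A), S B f -> cov (pull_sieve f R)) -> cov R }.

Definition matching (C : category) (F : psh C) (A : C) (S : sieve A)
    (x : forall (B : C) (f : hom B A), S B f -> members (F B)) : Prop :=
  forall (B D : C) (f : hom B A) (g : hom D B) (Sf : S B f),
    x D (comp f g) (sieve_comp g Sf) = fmap F g (x B f Sf).

Definition is_sheaf (C : category) (J : groth_topology C) (F : psh C) : Prop :=
  forall (A : C) (S : sieve A), J A S ->
  forall x : (forall (B : C) (f : hom B A), S B f -> members (F B)),
    matching x ->
    exists! y : members (F A),
      forall (B : C) (f : hom B A) (Sf : S B f), fmap F f y = x B f Sf.

Definition sh (C : category) (J : groth_topology C) : category :=
  full_subcat (is_sheaf J).

(* A topology together with an externology. topologicalType also carries a
   choice operator, so its equality would not be equality of topologies. *)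
Record ext_struct (T : Type) := ExtStruct {
  topen : set (set T);
  eopen : set (set T);
  topT : topen setT;
  topI : setI_closed topen;
  top_bigcup : forall F : set (set T), F `<=` topen ->
    topen (\bigcup_(U in F) U);
  eopen_sub : eopen `<=` topen;
  eopen_neq0 : eopen !=set0;
  eopenI : setI_closed eopen;
  eopen_up : forall E U : set T,
    eopen E -> topen U -> E `<=` U -> eopen U }.

Definition cont_map (S T : Type) (s : ext_struct S) (t : ext_struct T)
    (f : S -> T) : Prop :=
  forall U, topen t U -> topen s (f @^-1` U).

Definition ext_map (S T : Type) (s : ext_struct S) (t : ext_struct T)
    (f : S -> T) : Prop :=
  cont_map s t f /\ forall U, eopen t U -> eopen s (f @^-1` U).

Program Definition ext_d (T : topologicalType) : ext_struct T :=
  @ExtStruct T open open openT (@openI T) _ _ _ (@openI T) _.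
Next Obligation. by move=> T F Fo; apply: bigcup_open. Qed.
Next Obligation. by move=> T U. Qed.
Next Obligation. by move=> T; exists setT; apply: openT. Qed.
Next Obligation. by []. Qed.

Program Definition ext_cc (T : topologicalType) : ext_struct T :=
  @ExtStruct T open [set U | open U /\ compact (~` U)]
    openT (@openI T) _ _ _ _ _.
Next Obligation. by move=> T F Fo; apply: bigcup_open. Qed.
Next Obligation. by move=> T U []. Qed.
Next Obligation.
by move=> T; exists setT; split; [apply: openT|rewrite setCT; apply: compact0].
Qed.
Next Obligation.
move=> T U V [oU cU] [oV cV]; split; first exact: openI.
by rewrite setCI; apply: compactU.
Qed.
Next Obligation.
move=> T E U [oE cE] oU EU; split=> //.
apply: (subclosed_compact _ cE); first exact: open_closedC.
by move=> x Ux /EU.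
Qed.

Definition ext_discrete (T : Type) : ext_struct T :=
  @ExtStruct T setT setT I (fun _ _ _ _ => I) (fun _ _ => I) (fun _ _ => I)
    (ex_intro _ setT I) (fun _ _ _ _ => I) (fun _ _ _ _ _ => I).

(* The carrier of the one-point compactification of nat; None is infinity. *)
Definition Ninf : Set := option nat.

Definition one_d : ext_struct unit := ext_discrete unit.
Definition Ninf_d : ext_struct Ninf :=
  ext_d (one_point_compactification nat).
Definition nat_cc : ext_struct nat := ext_cc nat.

Section Sequential.
Context {T : Type} (t : ext_struct T).

Definition converges_to (s : nat -> T) (x : T) : Prop :=
  forall U, topen t U -> U x -> \forall n \near \oo, U (s n).

Definition ext_sequence (s : nat -> T) : Prop := ext_map nat_cc t s.

Definition seq_open (U : set T) : Prop :=
  forall (s : nat -> T) (x : T), converges_to s x -> U x ->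
    \forall n \near \oo, U (s n).

Definition seq_eopen (U : set T) : Prop :=
  seq_open U /\
  forall s : nat -> T, ext_sequence s -> \forall n \near \oo, U (s n).

Definition sequential : Prop := forall U, seq_open U -> topen t U.

Definition e_sequential : Prop :=
  sequential /\ forall U, seq_eopen U -> eopen t U.

End Sequential.

(* Exterior spaces with points in a type V, which plays the role of the
   ambient universe of points. An exterior space on a bare type T is the
   case V = T, points = setT. *)
Record ext_space (V : Type) := ExtSpace {
  points :> set V;
  ext_of :> ext_struct points }.

(* The set of exterior maps from A to X, as functions with values in V. *)
Definition ext_maps (A V : Type) (a : ext_struct A) (X : ext_space V) :
    set (A -> V) :=
  [set g | exists2 f : A -> points X, ext_map a (ext_of X) f & g = val \o f].

Lemma ext_map_comp (S T U : Type) (s : ext_struct S) (t : ext_struct T)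
    (u : ext_struct U) (g : T -> U) (f : S -> T) :
  ext_map t u g -> ext_map s t f -> ext_map s u (g \o f).
Proof.
move=> [cg eg] [cf ef]; split=> W.
- by move=> /cg /cf.
- by move=> /eg /ef.
Qed.

Lemma ext_map_id (T : Type) (t : ext_struct T) : ext_map t t id.
Proof. by split. Qed.

Lemma ext_maps_points (A V : Type) (a : ext_struct A) (X : ext_space V)
  (g : ext_maps a X) (x : A) : val g x \in points X.
Proof. by case: g => /= g /set_mem[f _ ->]; apply: valP. Qed.

Definition to_points (A V : Type) (a : ext_struct A) (X : ext_space V)
    (g : ext_maps a X) : A -> points X :=
  fun x => SigSub (ext_maps_points g x).

Lemma to_pointsP (A V : Type) (a : ext_struct A) (X : ext_space V)
  (g : ext_maps a X) : ext_map a (ext_of X) (to_points g).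
Proof.
have /set_mem[f fP gf] := valP g.
suff -> : to_points g = f by [].
by apply: funext => x; apply: val_inj; rewrite /= gf.
Qed.

Lemma precomp_subproof (B A V : Type) (b : ext_struct B) (a : ext_struct A)
    (X : ext_space V) (g : ext_maps a X) (f : B -> A) :
  ext_map b a f -> val g \o f \in ext_maps b X.
Proof.
move=> fP; apply/mem_set; exists (to_points g \o f) => //.
exact: ext_map_comp (to_pointsP g) fP.
Qed.

Definition precomp (B A V : Type) (b : ext_struct B) (a : ext_struct A)
    (X : ext_space V) (f : B -> A) (fP : ext_map b a f) (g : ext_maps a X) :
    ext_maps b X :=
  SigSub (precomp_subproof g fP).

Definition postcomp (A V : Type) (a : ext_struct A) (X Y : ext_space V)
    (h : ext_maps X Y) (g : ext_maps a X) : ext_maps a Y :=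
  precomp (to_pointsP g) h.

Program Definition ext_cat (V : Type) : category :=
  @Category (ext_space V) (fun X Y => ext_maps X Y)
    (fun X => SigSub (_ : val \in ext_maps X X))
    (fun X Y Z h g => postcomp h g) _ _ _.
Next Obligation.
by move=> V X; apply/mem_set; exists id => //; apply: ext_map_id.
Qed.
Next Obligation. by move=> *; apply: val_inj. Qed.
Next Obligation.
move=> V X Y f; apply: val_inj; apply: funext => x /=.
by congr (val f); apply: val_inj.
Qed.
Next Obligation.
move=> V X Y Z W h g f; apply: val_inj; apply: funext => x /=.
by congr (val h); apply: val_inj.
Qed.

Definition eseq (V : Type) : category :=
  @full_subcat (ext_cat V) (fun X : ext_space V => e_sequential (ext_of X)).

Inductive Cob := C_one | C_ninf | C_nat.

Definition Cpoints (A : Cob) : Set :=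
  match A with C_one => unit | C_ninf => Ninf | C_nat => nat end.

Definition Cext (A : Cob) : ext_struct (Cpoints A) :=
  match A with C_one => one_d | C_ninf => Ninf_d | C_nat => nat_cc end.

Definition Mplus : set (Ninf -> Ninf) := [set f | cont_map Ninf_d Ninf_d f].

Definition Mnat : set (nat -> nat) := [set f | ext_map nat_cc nat_cc f].

Definition Chom (A B : Cob) : set (Cpoints A -> Cpoints B) :=
  match A, B with
  | C_one, _ => setT
  | C_ninf, C_one => setT
  | C_ninf, C_ninf => Mplus
  | C_ninf, C_nat => range cst
  | C_nat, C_nat => Mnat
  | C_nat, _ => set0
  end.

Lemma top0 (T : Type) (t : ext_struct T) : topen t set0.
Proof. by rewrite -(bigcup_set0 id); apply: top_bigcup. Qed.

Lemma cont_map_cst (S T : Type) (s : ext_struct S) (t : ext_struct T) (y : T) :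
  cont_map s t (cst y).
Proof.
move=> U _; rewrite preimage_cst.
by case: ifP => _; [apply: topT|apply: top0].
Qed.

Lemma ext_map_d (S T : Type) (s : ext_struct S) (t : ext_struct T)
  (f : S -> T) : topen s `<=` eopen s -> cont_map s t f -> ext_map s t f.
Proof. by move=> ss cf; split=> // U /eopen_sub /cf /ss. Qed.

Lemma Chom_ext (A B : Cob) (f : Cpoints A -> Cpoints B) :
  Chom f -> ext_map (Cext A) (Cext B) f.
Proof.
case: A B f => [] [] f //= fP; try exact: ext_map_d.
- apply: ext_map_d => //; rewrite (_ : f = cst tt); first exact: cont_map_cst.
  by apply: funext => x; case: (f x).
- by case: fP => y _ <-; apply: ext_map_d => //; apply: cont_map_cst.
Qed.

Lemma Chom_id (A : Cob) : Chom (@id (Cpoints A)).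
Proof. by case: A => //=; apply: ext_map_id. Qed.

Lemma Mplus_comp (f g : Ninf -> Ninf) : Mplus f -> Mplus g -> Mplus (f \o g).
Proof. by move=> fP gP U /fP /gP. Qed.

Lemma Mplus_cst (y : Ninf) : Mplus (cst y).
Proof. exact: cont_map_cst. Qed.

Lemma Mnat_comp (f g : nat -> nat) : Mnat f -> Mnat g -> Mnat (f \o g).
Proof. exact: ext_map_comp. Qed.

Lemma unit_fun_cst (S T : Type) (g : unit -> T) (f : S -> unit) :
  g \o f = cst (g tt).
Proof. by apply: funext => x /=; case: (f x). Qed.

Lemma Chom_comp (A B D : Cob) (g : Cpoints B -> Cpoints D)
  (f : Cpoints A -> Cpoints B) : Chom g -> Chom f -> Chom (g \o f).
Proof.
case: A B D g f => [] [] [] g f //=.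
- by rewrite unit_fun_cst => _ _; apply: Mplus_cst.
- by rewrite unit_fun_cst => _ _; exists (g tt).
- exact: Mplus_comp.
- by move=> [y _ <-] _; exists y.
- by move=> _ [y _ <-]; exists (g y).
- exact: Mnat_comp.
Qed.

Program Definition Ccat : category :=
  @Category Cob (fun A B => @Chom A B)
    (fun A => SigSub (_ : id \in @Chom A A))
    (fun A B D g f => SigSub (_ : val g \o val f \in @Chom A D)) _ _ _.
Next Obligation. by move=> A; apply/mem_set/Chom_id. Qed.
Next Obligation. by move=> *; apply/mem_set/Chom_comp; apply: set_valP. Qed.
Next Obligation. by move=> *; apply: val_inj. Qed.
Next Obligation. by move=> *; apply: val_inj. Qed.
Next Obligation. by move=> *; apply: val_inj. Qed.

Definition Cmap (A B : Ccat) (u : hom A B) : Cpoints A -> Cpoints B := val u.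

Lemma Cmap_ext (A B : Ccat) (u : hom A B) : ext_map (Cext A) (Cext B) (Cmap u).
Proof. exact: Chom_ext (set_valP u). Qed.

Definition le_Ninf (x y : Ninf) : bool :=
  match x, y with
  | _, None => true
  | None, Some _ => false
  | Some m, Some n => (m <= n)%N
  end.

Definition Eplus : set (Ninf -> Ninf) :=
  [set u | [/\ Mplus u, {homo u : x y / le_Ninf x y} & injective u]].

Definition Enat : set (nat -> nat) :=
  [set u | [/\ Mnat u, {homo u : m n / (m <= n)%N} & injective u]].

Definition right_ideal (T : Type) (M I : set (T -> T)) : Prop :=
  I `<=` M /\ forall f g, I f -> M g -> I (f \o g).

Definition Jc : set (set (Ninf -> Ninf)) :=
  [set I | [/\ right_ideal Mplus I, forall c, I (cst c) &
    forall u, Eplus u -> exists2 v, Eplus v & I (u \o v)]].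

Definition Je : set (set (nat -> nat)) :=
  [set I | right_ideal Mnat I /\
    forall u, Enat u -> exists2 v, Enat v & I (u \o v)].

Definition Jcov (A : Ccat) : sieve A -> Prop :=
  match A return @sieve Ccat A -> Prop with
  | C_one => fun S => forall (B : Ccat) (f : hom B C_one), S B f
  | C_ninf => fun S => exists2 I, Jc I &
      [/\ forall f : hom (C_one : Ccat) C_ninf, S C_one f &
          forall f : hom (C_ninf : Ccat) C_ninf, S C_ninf f <-> I (Cmap f)]
  | C_nat => fun S => exists2 I, Je I &
      [/\ forall f : hom (C_one : Ccat) C_nat, S C_one f,
          forall f : hom (C_ninf : Ccat) C_nat, S C_ninf f &
          forall f : hom (C_nat : Ccat) C_nat, S C_nat f <-> I (Cmap f)]
  end.

Lemma nat_open (U : set nat) : open U.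
Proof.
rewrite openE => x Ux; rewrite /interior nbhs_principalE.
exact/principal_filterP.
Qed.

Lemma nat_compact_bounded (K : set nat) :
  compact K -> \forall n \near \oo, (~` K) n.
Proof.
move=> /compact_near_coveringP /(_ nat \oo (fun n x => (x < n)%N)) cK.
have /cK : forall x : nat, K x ->
    \forall x' \near x & n \near \oo, (x' < n)%N.
  move=> x _; exists ([set x], [set n | (x < n)%N]) => /=.
    by split; [rewrite nbhs_principalE; apply/principal_filterP|exists x.+1].
  by move=> [y n] /= [-> ].
move=> [N _ NK]; exists N => // n /NK nK Kn.
by have := nK _ Kn; rewrite ltnn.
Qed.

Lemma nat_bounded_compact (U : set nat) :
  (\forall n \near \oo, U n) -> compact (~` U).
Proof.
move=> [N _ NU]; apply: finite_compact.
apply: (@sub_finite_set _ _ `I_N); last exact: finite_II.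
by move=> n nU; rewrite /= ltnNge; apply/negP => /NU.
Qed.

Lemma nat_ccP (U : set nat) : eopen nat_cc U <-> \forall n \near \oo, U n.
Proof.
split; first by case=> _ /nat_compact_bounded; rewrite setCK.
by move=> nU; split; [exact: nat_open|exact: nat_bounded_compact].
Qed.

Lemma Ninf_openP (U : set Ninf) :
  topen Ninf_d U <-> (U None -> \forall n \near \oo, U (Some n)).
Proof.
have -> : topen Ninf_d U = @open (one_point_compactification nat) U by [].
rewrite openE; split=> [oU /oU[K [/nat_compact_bounded nK _]] KU|oU].
- by apply: filterS nK => n nK; apply: KU; left; exists n.
- case=> [n Un|UN].
    rewrite /interior /nbhs /= /one_point_nbhs /= /fmap /= nbhs_principalE.
    exact/principal_filterP.
  have nU := oU UN; exists (~` [set n | U (Some n)]).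
    split; first exact: nat_bounded_compact.
    by apply: open_closedC; apply: nat_open.
  by move=> y [[n]|->//]; rewrite setCK => Un <-.
Qed.

Lemma strict_ge (v : nat -> nat) :
  {homo v : m n / (m < n)%N} -> forall n, (n <= v n)%N.
Proof. by move=> vm; elim=> // n /leq_ltn_trans; apply; apply: vm. Qed.

Lemma strict_le (v : nat -> nat) :
  {homo v : m n / (m < n)%N} -> {homo v : m n / (m <= n)%N}.
Proof.
by move=> vm m n; rewrite leq_eqVlt => /orP[/eqP ->//|/vm /ltnW].
Qed.

Lemma strict_inj (v : nat -> nat) : {homo v : m n / (m < n)%N} -> injective v.
Proof.
move=> vm m n e; case: (ltngtP m n) => // /vm; by rewrite e ltnn.
Qed.

Lemma near_strict (v : nat -> nat) (U : set nat) :
  {homo v : m n / (m < n)%N} ->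
  (\forall n \near \oo, U n) -> \forall n \near \oo, U (v n).
Proof.
move=> vm [N _ NU]; exists N => // n /= Nn.
by apply: NU; apply: leq_trans Nn (strict_ge vm n).
Qed.

Lemma Enat_strict (v : nat -> nat) :
  {homo v : m n / (m < n)%N} -> Enat v.
Proof.
move=> vm; split; [|exact: strict_le|exact: strict_inj].
split=> U; first by move=> _; apply: nat_open.
by move=> /nat_ccP /(near_strict vm) nU; apply/nat_ccP.
Qed.

Lemma Eplus_strict (v : nat -> nat) :
  {homo v : m n / (m < n)%N} -> Eplus (omap v).
Proof.
move=> vm; split.
- move=> U /Ninf_openP oU; apply/Ninf_openP => /oU nU.
  exact: (near_strict vm nU).
- by move=> [m|] [n|] //=; apply: strict_le.
- by move=> [m|] [n|] //= [/(strict_inj vm) ->].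
Qed.

Lemma Eplus_comp (u v : Ninf -> Ninf) : Eplus u -> Eplus v -> Eplus (u \o v).
Proof.
move=> [uM um ui] [vM vm vi]; split; first exact: Mplus_comp.
- by move=> x y /vm /um.
- exact: inj_comp.
Qed.

Lemma Enat_comp (u v : nat -> nat) : Enat u -> Enat v -> Enat (u \o v).
Proof.
move=> [uM um ui] [vM vm vi]; split; first exact: Mnat_comp.
- by move=> x y /vm /um.
- exact: inj_comp.
Qed.

Lemma Eplus_id : Eplus id.
Proof. by split. Qed.

Lemma Enat_id : Enat id.
Proof. by split=> //; apply: ext_map_id. Qed.

Lemma iter_strict (R : nat -> nat -> Prop) :
  (forall m, exists2 n, (m < n)%N & R m n) ->
  exists2 v : nat -> nat, {homo v : m n / (m < n)%N} &
    forall n, R (v n) (v n.+1).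
Proof.
move=> h; have [g gP] : {g : nat -> nat & forall m, (m < g m)%N /\ R m (g m)}.
  apply: (@choice _ _ (fun m n => (m < n)%N /\ R m n)) => m.
  by have [n] := h m; exists n.
exists (fun n => iter n g 0); last by move=> n; have [] := gP (iter n g 0).
apply: homo_ltn; first exact: ltn_trans.
by move=> n; have [] := gP (iter n g 0).
Qed.

Lemma Mnat_sub (w : nat -> nat) :
  Mnat w -> exists2 v, Enat v & Enat (w \o v).
Proof.
move=> [_ wM].
have [|v vm wv] := @iter_strict (fun m n => (w m < w n)%N).
  move=> m; have /wM /nat_ccP [N _ Nw] : eopen nat_cc [set n | (w m < n)%N].
    by apply/nat_ccP; exists (w m).+1.
  exists (maxn m.+1 N); first by rewrite leq_max leqnn.
  by apply: Nw; rewrite /= leq_max leqnn orbT.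
exists v; apply: Enat_strict => //.
by apply: homo_ltn => //; exact: ltn_trans.
Qed.

Lemma Mplus_sub (w : Ninf -> Ninf) : Mplus w ->
  exists2 v, Eplus v & Eplus (w \o v) \/ exists c, w \o v = cst c.
Proof.
move=> wM; have [[c cP]|nc] := pselect
    (exists c, forall m, exists2 n, (m < n)%N & w (Some n) = c).
  have [v vm wv] := @iter_strict (fun m n => w (Some n) = c) cP.
  exists (omap (v \o succn)).
    by apply: Eplus_strict => m n mn; apply: vm.
  right; exists c; apply: funext => -[n|] /=; first exact: wv.
  apply: contrapT => wc.
  have /wM /Ninf_openP /(_ wc) [N _ Nw] : topen Ninf_d (~` [set c]).
    apply/Ninf_openP; case: (c) => [m _|/(_ erefl)//].
    by exists m.+1 => // n mn [e]; move: mn; rewrite /= e ltnn.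
  by have [n Nn wn] := cP N; apply: (Nw n (ltnW Nn)).
have {}nc c : exists m, forall n, (m < n)%N -> w (Some n) <> c.
  apply: contrapT => h; apply: nc; exists c => m.
  apply: contrapT => h'; apply: h; exists m => n mn e.
  by apply: h'; exists n.
pose h n := odflt 0 (w (Some n)).
have hP k : exists N, forall n, (N < n)%N ->
    w (Some n) = Some (h n) /\ (k <= h n)%N.
  elim: k => [|k [N NP]].
    have [N NP] := nc None; exists N => n /NP; rewrite /h.
    by case: (w (Some n)).
  have [m mP] := nc (Some k); exists (maxn m N) => n.
  rewrite gtn_max => /andP[/mP wk /NP[wh kh]]; split=> //.
  rewrite ltn_neqAle kh andbT; apply/eqP => e.
  by apply: wk; rewrite wh e.
have wN : w None = None.
  case e : (w None) => [m|//].
  have /wM /Ninf_openP /(_ e) [N _ Nw] : topen Ninf_d [set Some m].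
    by apply/Ninf_openP.
  have [M MP] := nc (Some m).
  case: (MP (maxn M.+1 N)); first by rewrite leq_max leqnn.
  by apply: Nw; rewrite /= leq_max leqnn orbT.
have [m|v vm wv] := @iter_strict
    (fun m n => w (Some n) = Some (h n) /\ (h m < h n)%N).
  have [N NP] := hP (h m).+1; exists (maxn m N).+1.
    by rewrite ltnS leq_max leqnn.
  by apply: NP; rewrite ltnS leq_max leqnn orbT.
exists (omap (v \o succn)).
  by apply: Eplus_strict => m n mn; apply: vm.
left; rewrite (_ : _ \o _ = omap (h \o v \o succn)).
  apply: Eplus_strict; apply: homo_ltn; first exact: ltn_trans.
  by move=> n; have [] := wv n.+1.
by apply: funext => -[n|] //=; have [] := wv n.
Qed.

Local Notation one := (C_one : Ccat).
Local Notation ninf := (C_ninf : Ccat).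
Local Notation cnat := (C_nat : Ccat).

Lemma Cmap_comp (A B D : Ccat) (g : hom B D) (f : hom A B) :
  Cmap (comp g f) = Cmap g \o Cmap f.
Proof. by []. Qed.

Lemma CmapP (A B : Ccat) (f : Cpoints A -> Cpoints B) :
  Chom f -> exists u : hom A B, Cmap u = f.
Proof. by move=> fP; exists (SigSub (mem_set fP)). Qed.

Lemma Cmap_inj (A B : Ccat) : injective (@Cmap A B).
Proof. exact: val_inj. Qed.

Lemma Jcov_ninfP (S : sieve ninf) : Jcov S <->
  (forall f : hom one ninf, S one f) /\
  forall u, Eplus u -> exists2 v, Eplus v &
    exists2 f : hom ninf ninf, Cmap f = u \o v & S ninf f.
Proof.
split=> [[I [[IM _] _ IE] [S1 SI]]|[S1 SE]].
  split=> // u /IE[v vE Iuv]; exists v => //.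
  have [f fuv] := @CmapP ninf ninf (u \o v) (IM _ Iuv).
  by exists f => //; apply/SI; rewrite fuv.
exists [set w | exists2 f : hom ninf ninf, Cmap f = w & S ninf f]; last first.
  split=> // f; split=> [Sf|[g /Cmap_inj <-]//]; by exists f.
split; last exact: SE.
  split=> [w [f <- _]|w g [f <- Sf] gM]; first exact: (set_valP f).
  have [h hg] := @CmapP ninf ninf g gM.
  by exists (comp f h); [rewrite Cmap_comp hg|apply: sieve_comp].
move=> c; have [p pc] := @CmapP one ninf (cst c) Logic.I.
have [t _] := @CmapP ninf one (cst tt) Logic.I.
exists (comp p t); last exact: sieve_comp.
by rewrite Cmap_comp pc.
Qed.

Lemma Jcov_natP (S : sieve cnat) : Jcov S <->
  [/\ forall f : hom one cnat, S one f, forall f : hom ninf cnat, S ninf f &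
  forall u, Enat u -> exists2 v, Enat v &
    exists2 f : hom cnat cnat, Cmap f = u \o v & S cnat f].
Proof.
split=> [[I [[IM _] IE] [S1 Sinf SI]]|[S1 Sinf SE]].
  split=> // u /IE[v vE Iuv]; exists v => //.
  have [f fuv] := @CmapP cnat cnat (u \o v) (IM _ Iuv).
  by exists f => //; apply/SI; rewrite fuv.
exists [set w | exists2 f : hom cnat cnat, Cmap f = w & S cnat f]; last first.
  split=> // f; split=> [Sf|[g /Cmap_inj <-]//]; by exists f.
split; last exact: SE.
split=> [w [f <- _]|w g [f <- Sf] gM]; first exact: (set_valP f).
have [h hg] := @CmapP cnat cnat g gM.
by exists (comp f h); [rewrite Cmap_comp hg|apply: sieve_comp].
Qed.

Lemma Jcov_full (A : Ccat) (S : sieve A) :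
  (forall (B : Ccat) (f : hom B A), S B f) -> Jcov S.
Proof.
case: A S => S Sfull.
- exact: Sfull.
- apply/Jcov_ninfP; split=> [f|u uE]; first exact: Sfull.
  have [f fu] := @CmapP ninf ninf u (let: And3 h _ _ := uE in h).
  by exists id; [exact: Eplus_id|exists f].
- apply/Jcov_natP; split=> [f|f|u uE]; [exact: Sfull|exact: Sfull|].
  have [f fu] := @CmapP cnat cnat u (let: And3 h _ _ := uE in h).
  by exists id; [exact: Enat_id|exists f].
Qed.

Lemma Jcov_max (A : Ccat) : Jcov (max_sieve A).
Proof. exact: Jcov_full. Qed.

Lemma Jcov_points (A : Ccat) (S : sieve A) :
  Jcov S -> forall f : hom one A, S one f.
Proof.
case: A S => S; first by move=> h f; apply: h.
- by case/Jcov_ninfP.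
- by case/Jcov_natP.
Qed.

Lemma sieve_ninf_cst (A : Ccat) (S : sieve A) (f : hom ninf A) (c : Cpoints A) :
  (forall p : hom one A, S one p) -> Cmap f = cst c -> S ninf f.
Proof.
move=> S1 fc; have [p pc] := @CmapP one A (cst c) Logic.I.
have [t _] := @CmapP ninf one (cst tt) Logic.I.
rewrite (_ : f = comp p t); first exact: sieve_comp.
by apply: Cmap_inj; rewrite Cmap_comp pc fc.
Qed.

Lemma Jcov_pull (A B : Ccat) (f : hom B A) (S : sieve A) :
  Jcov S -> Jcov (pull_sieve f S).
Proof.
move=> JS; have S1 := Jcov_points JS.
case: B f => f.
- apply: Jcov_full => -[] g /=; [exact: S1| |by have := set_valP g].
  exact: (sieve_comp g (S1 f)).
- apply/Jcov_ninfP; split=> [g|u uE]; first exact: S1.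
  case: A f S JS S1 => f S JS S1.
  + exists id; first exact: Eplus_id.
    have [g gu] := @CmapP ninf ninf u (let: And3 h _ _ := uE in h).
    by exists g => //; apply: JS.
  + have [uM _ _] := uE.
    have [v vE fuv] := Mplus_sub (Mplus_comp (set_valP f) uM).
    have vM : Mplus v by case: vE.
    case: fuv => [fuvE|[c fuvc]].
    * have [_ /(_ _ fuvE)[v' v'E [g gE Sg]]] := (Jcov_ninfP S).1 JS.
      exists (v \o v'); first exact: Eplus_comp.
      have v'M : Mplus v' by case: v'E.
      have [k ku] := @CmapP ninf ninf (u \o (v \o v'))
        (Mplus_comp uM (Mplus_comp vM v'M)).
      have fk : comp f k = g by apply: Cmap_inj; rewrite Cmap_comp ku gE.
      by exists k => //; exact: (eq_ind_r (S ninf) Sg fk).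
    * exists v => //.
      have [k ku] := @CmapP ninf ninf (u \o v) (Mplus_comp uM vM).
      exists k => //; apply: (sieve_ninf_cst (f := comp f k) (c := c)) => //.
      by rewrite Cmap_comp ku -fuvc.
  + have [uM _ _] := uE.
    have [_ Sinf _] := (Jcov_natP S).1 JS.
    exists id; first exact: Eplus_id.
    have [k ku] := @CmapP ninf ninf u uM.
    by exists k => //; apply: Sinf.
- case: A f S JS S1 => f S JS S1; try by have := set_valP f.
  have [_ Sinf SE] := (Jcov_natP S).1 JS.
  apply/Jcov_natP; split=> [g|g|u uE]; [exact: S1|exact: Sinf|].
  have [uM _ _] := uE.
  have [v vE fuvE] := Mnat_sub (Mnat_comp (set_valP f) uM).
  have [v' v'E [g gE Sg]] := SE _ fuvE.
  have [vM _ _] := vE; have [v'M _ _] := v'E.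
  exists (v \o v'); first exact: Enat_comp.
  have [k ku] := @CmapP cnat cnat (u \o (v \o v'))
    (Mnat_comp uM (Mnat_comp vM v'M)).
  have fk : comp f k = g by apply: Cmap_inj; rewrite Cmap_comp ku gE.
  by exists k => //; exact: (eq_ind_r (S cnat) Sg fk).
Qed.

Lemma Jcov_trans (A : Ccat) (S R : sieve A) : Jcov S ->
  (forall (B : Ccat) (f : hom B A), S B f -> Jcov (pull_sieve f R)) -> Jcov R.
Proof.
move=> JS SR; have S1 := Jcov_points JS.
have R1 (p : hom one A) : R one p.
  have Rp : R one (comp p (idc one)) := SR one p (S1 p) one (idc one).
  by rewrite comp_idr in Rp.
case: A S R JS SR S1 R1 => S R JS SR S1 R1.
- apply: Jcov_full => B f.
  by have Rf := sieve_comp f (R1 (idc one)); rewrite comp_idl in Rf.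
- apply/Jcov_ninfP; split=> // u uE.
  have [_ /(_ u uE)[v vE [f fuv Sf]]] := (Jcov_ninfP S).1 JS.
  have [_ /(_ id Eplus_id)[w wE [g gw Rg]]] :=
    (Jcov_ninfP _).1 (SR _ f Sf).
  exists (v \o w); first exact: Eplus_comp.
  by exists (comp f g) => //; rewrite Cmap_comp fuv gw.
- apply/Jcov_natP; split=> // [f|u uE].
    by have [c _ fc] := set_valP f; apply: (sieve_ninf_cst (f := f) (c := c)).
  have [_ _ /(_ u uE)[v vE [f fuv Sf]]] := (Jcov_natP S).1 JS.
  have [_ _ /(_ id Enat_id)[w wE [g gw Rg]]] :=
    (Jcov_natP _).1 (SR _ f Sf).
  exists (v \o w); first exact: Enat_comp.
  by exists (comp f g) => //; rewrite Cmap_comp fuv gw.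
Qed.

Definition J : groth_topology Ccat :=
  GrothTopology Jcov_max Jcov_pull Jcov_trans.

Section Presheaf.
Context {V : Type}.

Program Definition Sigma_ob (X : ext_cat V) : psh Ccat :=
  @Functor (opcat Ccat) set_cat
    (fun A : Cob => SSet (ext_maps (Cext A) X))
    (fun (A B : Cob) (u : @hom Ccat B A) => precomp (Cmap_ext u)) _ _.
Next Obligation. by move=> X A; apply: funext => g; apply: val_inj. Qed.
Next Obligation. by move=> X A B D v u; apply: funext => g; apply: val_inj. Qed.

Program Definition Sigma_map (X Y : ext_cat V) (h : hom X Y) :
    @hom (psh Ccat) (Sigma_ob X) (Sigma_ob Y) :=
  @NatTrans (opcat Ccat) set_cat (Sigma_ob X) (Sigma_ob Y)
    (fun A : Cob => @postcomp _ _ (Cext A) X Y h) _.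
Next Obligation.
move=> X Y h A B u; apply: funext => g; apply: val_inj; apply: funext => x /=.
by congr (val h); apply: val_inj.
Qed.

Program Definition Sigma : functor (ext_cat V) (psh Ccat) :=
  @Functor (ext_cat V) (psh Ccat) Sigma_ob Sigma_map _ _.
Next Obligation.
by move=> X; apply: nat_trans_eq => A; apply: funext => g; apply: val_inj.
Qed.
Next Obligation.
move=> X Y Z h k; apply: nat_trans_eq => A; apply: funext => g; apply: val_inj.
by apply: funext => x /=; congr (val h); apply: val_inj.
Qed.

End Presheaf.

Arguments Sigma V : clear implicits.

(* Main.v *)
Require Import Defs.
From mathcomp Require Import all_boot.
From mathcomp Require Import all_classical.
From mathcomp Require Import topology.

(** The three objects of the site see exactly the data that determines an
    e-sequential exterior space: maps out of [1] are its points, maps out of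
    [N+] its convergent sequences with a limit, and maps out of [N] its
    exterior sequences.

    Sheaf condition.  A covering sieve contains all points of the object that
    it covers, so a matching family has at most one amalgamation, and the
    values of the family at the points are the only candidate, [glue].  By
    [glueE] its restriction along any arrow of the sieve is the member of the
    family there, which is an exterior map.  It remains to show that [glue]
    itself is exterior.  This is the familiar principle that a sequence
    converges to a limit (or is exterior) as soon as every subsequence has a
    further subsequence that does: were an open set missed infinitely often,
    the indices where it is missed would form a subsequence without such a
    further subsequence.  The condition on [J_c] and [J_e] that every [u] in
    [E] has a [v] in [E] with [u o v] in the ideal provides the further
    subsequences ([subseq_converges] and [subseq_exterior]).

    Full and faithful.  A natural transformation [t] from [Sigma X] to
    [Sigma Y] acts on points by a map [on_points], and naturality along points
    forces [t] to be composition with it on every object.  So [on_points]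
    preserves convergent sequences and exterior sequences, and on an
    e-sequential space this makes it an exterior map ([sequential_ext_map]).

    Injective on objects.  [Sigma X] determines the set of points of [X] as the
    set of values of the constant maps on [1], and then, for e-sequential [X],
    both the topology and the externology: if two e-sequential structures on
    one set have the same convergent and exterior sequences, the identity is
    exterior in both directions. *)

Set Implicit Arguments.
Unset Strict Implicit.
Unset Printing Implicit Defensive.

Local Open Scope classical_set_scope.

(** * Exterior maps out of the objects of the site *)

Lemma ext_map_one (T : Type) (t : ext_struct T) (f : unit -> T) :
  ext_map one_d t f.
Proof. by []. Qed.

Lemma ext_map_ninfP (T : Type) (t : ext_struct T) (f : Ninf -> T) :
  ext_map Ninf_d t f <-> converges_to t (f \o Some) (f None).
Proof.
split=> [[fc _] U oU fU|fc]; first exact: (Ninf_openP _).1 (fc _ oU) fU.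
by apply: ext_map_d => // U oU; apply/Ninf_openP => fU; apply: fc.
Qed.

Lemma ext_map_natP (T : Type) (t : ext_struct T) (f : nat -> T) :
  ext_map nat_cc t f <-> forall U, eopen t U -> \forall n \near \oo, U (f n).
Proof.
split=> [[_ fe] U /fe /nat_ccP//|fe]; split=> U.
  by move=> _; apply: nat_open.
by move=> /fe fU; apply/nat_ccP.
Qed.

Lemma frequently_subseq (P : set nat) : ~ (\forall n \near \oo, ~ P n) ->
  exists2 u : nat -> nat, {homo u : m n / (m < n)%N} & forall n, P (u n).
Proof.
move=> nP; have [m|u um uP] := @iter_strict (fun _ n => P n).
  apply: contrapT => h; apply: nP; exists m.+1 => // n mn Pn.
  by apply: h; exists n.
(* [iter_strict] constrains only the terms that have a predecessor, so the
   initial term is dropped. *)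
exists (u \o succn) => [m n mn|n]; [exact: um|exact: uP].
Qed.

(** If a finite value were taken at infinity, continuity would make the map
    eventually equal to that value, against injectivity. *)
Lemma Eplus_infty (v : Ninf -> Ninf) : Eplus v -> v None = None.
Proof.
move=> [vM _ vi]; case e : (v None) => [m|//].
have /vM /Ninf_openP /(_ e) [N _ Nv] : topen Ninf_d [set Some m].
  by apply/Ninf_openP.
by have := vi None (Some N); rewrite e (Nv N (leqnn N)) => /(_ erefl).
Qed.

(** If an open neighbourhood of [y None] were missed infinitely often, [u] would
    enumerate the indices where it is missed; but [y \o (u \o v)] still tends to
    [y None], because [u] and [v] fix infinity. *)
Lemma subseq_converges (T : Type) (t : ext_struct T) (y : Ninf -> T) :
  (forall u, Eplus u -> exists2 v, Eplus v & ext_map Ninf_d t (y \o (u \o v))) ->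
  ext_map Ninf_d t y.
Proof.
move=> yE; apply/ext_map_ninfP => U oU yU.
apply: contrapT => nU.
have [|u um uU] := @frequently_subseq (fun n => ~ U (y (Some n))).
  by apply: contra_not nU; apply: filterS => n /contrapT.
have [v vE /ext_map_ninfP yv] := yE _ (Eplus_strict um).
have v0 := Eplus_infty vE; have [_ _ vi] := vE.
have [|N _ /(_ N (leqnn N))] := yv U oU; first by rewrite /= v0.
(* Injectivity keeps [v (Some N)] finite, so it is an index chosen by [u]. *)
rewrite /=; case e : (v (Some N)) => [k|] /=; first exact: uU.
by have := vi (Some N) None; rewrite e v0 => /(_ erefl).
Qed.

(** The externology analogue of [subseq_converges], with e-open sets in the
    place of the neighbourhoods of the limit. *)
Lemma subseq_exterior (T : Type) (t : ext_struct T) (y : nat -> T) :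
  (forall u, Enat u -> exists2 v, Enat v & ext_map nat_cc t (y \o (u \o v))) ->
  ext_map nat_cc t y.
Proof.
move=> yE; apply/ext_map_natP => U eU.
apply: contrapT => nU.
have [|u um uU] := @frequently_subseq (fun n => ~ U (y n)).
  by apply: contra_not nU; apply: filterS => n /contrapT.
have [v _ /ext_map_natP/(_ U eU)] := yE _ (Enat_strict um).
by case=> N _ /(_ N (leqnn N)); apply: uU.
Qed.

(** * The sheaf condition *)

Definition point (A : Ccat) (c : Cpoints A) : hom (C_one : Ccat) A :=
  SigSub (mem_set (Logic.I : @Chom C_one A (cst c))).

Lemma comp_point (A B : Ccat) (f : hom A B) (c : Cpoints A) :
  Defs.comp f (point c) = point (Cmap f c).
Proof. exact: Cmap_inj. Qed.

Lemma to_points_val (A V : Type) (a : ext_struct A) (X : ext_space V)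
    (g : ext_maps a X) : val g = val \o to_points g.
Proof. by []. Qed.

Section SheafCondition.
Context {V : Type} {X : ext_space V} {A : Ccat} {S : sieve A}.
Context (x : forall (B : Ccat) (f : hom B A), S B f ->
  members (Sigma V X B)).
Context (x_matching : matching (F := Sigma V X) x).
Context (S_points : forall p : hom (C_one : Ccat) A, S C_one p).

Definition glue (c : Cpoints A) : points X :=
  to_points (x (S_points (point c))) tt.

(** Equal arrows may carry different proofs of membership in the sieve, so this
    needs proof irrelevance. *)
Lemma family_irr (B : Ccat) (f g : hom B A) (Sf : S B f) (Sg : S B g) :
  f = g -> x Sf = x Sg.
Proof. by move=> fg; case: _ / fg Sg => Sg; congr x; apply: Prop_irrelevance. Qed.

(** Evaluate at [b]: the family matches along the point [b] of [B], and
    [f] sends that point to the point [f b] of [A], where [glue] was defined. *)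
Lemma glueE (B : Ccat) (f : hom B A) (Sf : S B f) :
  glue \o Cmap f = to_points (x Sf).
Proof.
apply: funext => b; apply: val_inj; rewrite /glue /=.
have := x_matching (point b) Sf.
rewrite (family_irr _ (S_points (point (Cmap f b))) (comp_point f b)) => ->.
by [].
Qed.

Lemma glue_ext_map (B : Ccat) (f : hom B A) : S B f ->
  ext_map (Cext B) X (glue \o Cmap f).
Proof. by move=> Sf; rewrite (glueE Sf); apply: to_pointsP. Qed.

Lemma glue_amalgamation : ext_map (Cext A) X glue ->
  exists! y : members (Sigma V X A),
    forall (B : Ccat) (f : hom B A) (Sf : S B f),
      Defs.fmap (Sigma V X) f y = x Sf.
Proof.
move=> gP.
have gM : val \o glue \in ext_maps (Cext A) X by apply/mem_set; exists glue.
exists (SigSub gM); split=> [B f Sf|y yP].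
  apply: val_inj; rewrite [RHS]to_points_val -glueE.
  by [].
apply: val_inj; apply: funext => c; rewrite /= -yP.
by [].
Qed.

End SheafCondition.

Lemma Sigma_sheaf (V : Type) (X : ext_cat V) : is_sheaf J (Sigma V X).
Proof.
move=> A S JS x xM; have S1 := Jcov_points JS.
apply: (glue_amalgamation xM (S_points := S1)).
have gS := glue_ext_map xM S1.
case: A S JS x xM S1 gS => S JS x xM S1 gS.
- exact: ext_map_one.
- apply: subseq_converges => u /((Jcov_ninfP S).1 JS).2[v vE [f fuv Sf]].
  by exists v => //; rewrite -fuv; apply: (gS C_ninf f Sf).
- apply: subseq_exterior => u; have [_ _ SE] := (Jcov_natP S).1 JS.
  move=> /SE[v vE [f fuv Sf]].
  by exists v => //; rewrite -fuv; apply: (gS C_nat f Sf).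
Qed.

(** * Fullness and faithfulness *)

(** On an e-sequential space, preserving convergent sequences and exterior
    sequences is enough: it makes preimages of open sets sequentially open and
    preimages of e-open sets sequentially e-open. *)
Lemma sequential_ext_map (S T : Type) (s : ext_struct S) (t : ext_struct T)
    (h : S -> T) : e_sequential s ->
  (forall f, ext_map Ninf_d s f -> ext_map Ninf_d t (h \o f)) ->
  (forall f, ext_map nat_cc s f -> ext_map nat_cc t (h \o f)) ->
  ext_map s t h.
Proof.
move=> [sS eS] hinf hnat.
have hc U : topen t U -> seq_open s (h @^-1` U).
  move=> oU f x fx hx.
  pose g (n : Ninf) := if n is Some k then f k else x.
  (* [f] with its limit as value at infinity is an exterior map on [N+]. *)
  by have /ext_map_ninfP := hinf g ((ext_map_ninfP _ _).2 fx); apply.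
split=> U; first by move=> /hc /sS.
move=> eU; apply: eS; split; first exact: hc (eopen_sub eU).
by move=> f /hnat /ext_map_natP; apply.
Qed.

Section SigmaHom.
Context {V : Type}.

Lemma in_ext_maps (A : Type) (a : ext_struct A) (X : ext_space V)
  (f : A -> points X) : ext_map a X f -> val \o f \in ext_maps a X.
Proof. by move=> fP; apply/mem_set; exists f. Qed.

Definition mk_ext (A : Type) (a : ext_struct A) (X : ext_space V)
    (f : A -> points X) (fP : ext_map a X f) : ext_maps a X :=
  SigSub (in_ext_maps fP).

Lemma to_points_mk (A : Type) (a : ext_struct A) (X : ext_space V)
  (f : A -> points X) (fP : ext_map a X f) : to_points (mk_ext fP) = f.
Proof. by apply: funext => c; apply: val_inj. Qed.

Definition pt (X : ext_space V) (p : points X) : ext_maps one_d X :=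
  mk_ext (ext_map_one X (cst p)).

Section Full.
Context (X Y : ext_cat V) (t : @hom (psh Ccat) (Sigma V X) (Sigma V Y)).

Definition on_points (p : points X) : points Y :=
  to_points (ncomp t C_one (pt p) : ext_maps one_d Y) tt.

(** Naturality along the point [c] of [A] identifies the value at [c] of the
    transformed map with the transform of the point [g c]. *)
Lemma nat_transE (A : Ccat) (g : ext_maps (Cext A) X) :
  to_points (ncomp t A g : ext_maps (Cext A) Y) = on_points \o to_points g.
Proof.
apply: funext => c; apply: val_inj => /=.
have /(congr1 (fun k => val (k g) tt)) /= :=
  naturality t (point c : @hom (opcat Ccat) A C_one).
move=> <-; congr (val (ncomp t C_one _) tt).
by apply: val_inj; apply: funext => -[].
Qed.

Lemma on_points_ext (A : Ccat) (f : Cpoints A -> points X) :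
  ext_map (Cext A) X f -> ext_map (Cext A) Y (on_points \o f).
Proof.
move=> fP; rewrite -(to_points_mk fP) -nat_transE; exact: to_pointsP.
Qed.

Lemma Sigma_full_at : e_sequential (ext_of X) ->
  exists h : hom X Y, Defs.fmap (Sigma V) h = t.
Proof.
move=> eX; have hP : ext_map X Y on_points.
  apply: sequential_ext_map => //.
    exact: (@on_points_ext C_ninf).
  exact: (@on_points_ext C_nat).
exists (mk_ext hP); apply: nat_trans_eq => A; apply: funext => g.
apply: val_inj; rewrite [RHS]to_points_val nat_transE.
by [].
Qed.

End Full.

Lemma Sigma_faithful : faithful (Sigma V).
Proof.
move=> X Y h k hk; apply: val_inj; apply: funext => p.
have /= := congr1 (fun t : @hom (psh Ccat) (Sigma V X) (Sigma V Y) =>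
  val (ncomp t C_one (pt p)) tt) hk.
(* The two points differ only in their membership proofs. *)
by rewrite (val_inj (erefl : val (to_points (pt p) tt) = val p)).
Qed.

End SigmaHom.

(** * Injectivity on objects *)

(** The predicate [mem_at] recovers the members through a cast between ambient
    types; the cast is the identity because equality proofs are unique. *)
Lemma SSet_inj (T : Type) (A B : set T) : SSet A = SSet B -> A = B.
Proof.
pose mem_at S x := exists e : ambient S = T, members S (ecast U U (esym e) x).
have memE C : mem_at (SSet C) = C.
  apply/seteqP; split=> x; last by exists erefl.
  by case=> e; rewrite (Prop_irrelevance e erefl).
by rewrite -{2}(memE A) -{2}(memE B) => ->.
Qed.

Lemma ext_struct_eq (T : Type) (s t : ext_struct T) :
  topen s = topen t -> eopen s = eopen t -> s = t.
Proof.
case: s t => [o e ? ? ? ? ? ? ?] [o' e' ? ? ? ? ? ? ?] /= oo ee.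
by subst o' e'; congr ExtStruct; apply: Prop_irrelevance.
Qed.

(** The identity is exterior in both directions by [sequential_ext_map]. *)
Lemma e_sequential_eq (T : Type) (s t : ext_struct T) :
  e_sequential s -> e_sequential t ->
  (forall f, ext_map Ninf_d s f <-> ext_map Ninf_d t f) ->
  (forall f, ext_map nat_cc s f <-> ext_map nat_cc t f) -> s = t.
Proof.
move=> es et einf enat.
have [st ste] : ext_map s t id.
  by apply: sequential_ext_map => // f; [move=> /einf|move=> /enat].
have [ts tse] : ext_map t s id.
  by apply: sequential_ext_map => // f; [move=> /einf|move=> /enat].
apply: ext_struct_eq; apply/seteqP; split=> U;
  [exact: ts|exact: st|exact: tse|exact: ste].
Qed.

Lemma ext_mapsP (V A : Type) (a : ext_struct A) (X : ext_space V)
  (f : A -> points X) : ext_map a X f <-> ext_maps a X (val \o f).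
Proof.
split=> [fP|[g gP fg]]; first by exists f.
rewrite (_ : f = g) //; apply: funext => x; apply: val_inj.
exact: (congr1 (fun k : A -> V => k x) fg).
Qed.

Lemma points_ext_maps (V : Type) (X : ext_space V) :
  points X = [set p | ext_maps one_d X (cst p)].
Proof.
apply/seteqP; split=> [p Xp|p [f _ pf]].
  by exists (cst (SigSub (mem_set Xp))).
have -> : p = val (f tt) by exact: (congr1 (fun k : unit -> V => k tt) pf).
exact: set_valP.
Qed.

Lemma Sigma_ob_inj (V : Type) (X Y : ext_space V) :
  e_sequential X -> e_sequential Y -> Sigma_ob X = Sigma_ob Y -> X = Y.
Proof.
move=> eX eY XY.
have E (A : Cob) : ext_maps (Cext A) X = ext_maps (Cext A) Y.
  by have := congr1 (fun F : psh Ccat => fobj F A) XY; apply: SSet_inj.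
have pE : points X = points Y by rewrite !points_ext_maps; have /= -> := E C_one.
case: X Y eX eY {XY} E pE => [P s] [Q t] /= es et E pE.
case: _ / pE t et E => t et E; congr ExtSpace.
have maps (A : Cob) (f : Cpoints A -> P) :
    ext_map (Cext A) s f <-> ext_map (Cext A) t f.
  have := E A; rewrite (@ext_mapsP _ _ _ (ExtSpace s)) => ->.
  by rewrite (@ext_mapsP _ _ _ (ExtSpace t)).
by apply: e_sequential_eq => // f; [apply: (maps C_ninf)|apply: (maps C_nat)].
Qed.

Theorem theorem4p16 (V : Type) :
  exists Sigma_sheaf : forall X : ext_cat V,
      e_sequential (ext_of X) -> is_sheaf J (Sigma V X),
    full_embedding
      (restrict_functor Sigma_sheaf : functor (eseq V) (sh J)).
Proof.
exists (fun X _ => Sigma_sheaf (X := X)); split.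
- move=> [X eX] [Y eY] t; exact: Sigma_full_at.
- move=> [X eX] [Y eY]; exact: Sigma_faithful.
- move=> [X eX] [Y eY] /(congr1 sval) /= /(Sigma_ob_inj eX eY) XY.
  by case: _ / XY eY => eY; congr exist; apply: Prop_irrelevance.
Qed.
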